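(* Let $q=p^n$, where $p$ is a prime and $q>2$. Let $B(T)=(T^q-T)^{q-1}-x$ and consider $B(T)$ as an element of $\mathbb{F}_p(x)[T]$. Then the Galois group $\Gamma$ of $B(T)$ over $\mathbb{F}_p(x)$ is isomorphic to the automorphism group of the affine general linear group $AGL_1(\mathbb{F}_q)$ and has order $nq(q-1)$.
   Context: $AGL_1(\mathbb{F}_q)$ is the group of all affine transformations $x\mapsto ax+b$ with $a,b\in\mathbb{F}_q$, $a\neq0$. $\mathbb{F}_p(x)$ is the field of rational functions in an indeterminate $x$ over $\mathbb{F}_p$. *)

(* Defs.v *)
From HB Require Import structures.
From mathcomp Require Import all_boot all_order all_fingroup all_algebra.
From mathcomp Require Import all_solvable all_field.

Set Implicit Arguments.
Unset Strict Implicit.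
Unset Printing Implicit Defensive.

Import GroupScope GRing.Theory.
Local Open Scope ring_scope.

(* A group of permutations of F; the product of {perm F} is composition in
   diagrammatic order, which does not affect the isomorphism type. *)
Definition AGL1 (F : finFieldType) : {set {perm F}} :=
  [set s : {perm F} |
    [exists a : F, exists b : F, (a != 0) && [forall x : F, s x == a * x + b]]].

Lemma AGL1P (F : finFieldType) (s : {perm F}) :
  reflect (exists a b : F, a != 0 /\ forall x, s x = a * x + b) (s \in AGL1 F).
Proof.
rewrite inE; apply: (iffP existsP) => [[a /existsP[b /andP[a0 /forallP h]]]|].
  by exists a, b; split=> // x; apply/eqP.
case=> a [b [a0 h]]; exists a; apply/existsP; exists b; rewrite a0 /=.
by apply/forallP => x; rewrite h.
Qed.

Lemma AGL1_group_set (F : finFieldType) : group_set (AGL1 F).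
Proof.
apply/group_setP; split=> [|s t].
  apply/AGL1P; exists 1, 0; split=> [|x]; first exact: oner_neq0.
  by rewrite perm1 mul1r addr0.
move=> /AGL1P[a [b [a0 hs]]] /AGL1P[c [d [c0 ht]]]; apply/AGL1P.
exists (c * a), (c * b + d); split=> [|x]; first by rewrite mulf_neq0.
by rewrite permM hs ht mulrDr mulrA addrA.
Qed.

Canonical AGL1_group (F : finFieldType) : {group {perm F}} :=
  Group (AGL1_group_set F).

Definition ratfun (p : nat) : fieldType := {fraction {poly 'F_p}}.

Definition ratfun_x (p : nat) : ratfun p := tofrac ('X : {poly 'F_p}).

Definition polyB (p q : nat) : {poly ratfun p} :=
  ('X^q - 'X) ^+ q.-1 - (ratfun_x p)%:P.

(* Main.v *)
Require Import Defs.
From HB Require Import structures.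
From mathcomp Require Import all_boot all_order all_fingroup all_algebra.
From mathcomp Require Import all_solvable all_field ring.

(** Write F for the field with q elements, A for its affine group, K for the
field of rational functions in x and G for the Galois group.

Let theta be a root of B.  The polynomial B (T + theta), expanded in powers of
T^q - T, has no constant term, so T^q - T divides it and splits in L: there is
an embedding iota of F in L ([splits_translate], [finField_embedding]).  Any
root theta' of B is then iota a * theta + iota b with a nonzero, because the
quotient of theta'^q - theta' by theta^q - theta is a (q-1)-st root of unity
([root_affine]).  Hence L = K (theta, iota F), and an automorphism sigma is
determined by the field automorphism that it induces on F and by the
element a theta + b to which it sends theta.

These two pieces of data are packaged in one permutation s of F: sigma maps
theta - iota z to a scalar multiple of theta - iota (s z).  This permutation
is a field automorphism of F followed by an affine map, so it
normalizes A, and s determines sigma ([gal_embeds_in_normalizer]).  As q > 2,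
the centralizer of A in the symmetric group of F is trivial ([cent_AGL1]);
conjugation therefore embeds G in Aut A.  Two estimates show that the
embedding is onto.

Upper bound, |Aut A| <= n q (q-1) ([card_Aut_AGL1_le]).  Let g generate the
multiplicative group of F.  An automorphism alpha of A is determined by the
images of the scaling x |-> g x and of the translation x |-> x + 1.  The
translations are the elements of A of order dividing p, so the second image is
one of q - 1 translations.  If the first image is x |-> a x + b, then alpha
acts on translations by an additive map turning multiplication by g into
multiplication by a; so a is a root of the minimal polynomial of g over F_p,
of degree at most n, and there are at most n q choices for (a, b).

Lower bound, |G| >= n q (q-1) ([order_gal_ge]).  Put E = K (iota g).  The
minimal polynomial of iota g over K divides T^q - T, so its coefficients are
constants, and they lie in F_p because theta is transcendental over F; as the
powers of g span F, it has degree at least n ([degree_constant_extension]).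
Next, the norm of theta from L to E is a product of polynomials a theta + b,
that is a polynomial in theta of degree |Gal (L / E)|; it is also an element
of E, a quotient C (x) / D (x) with x = (theta^q - theta)^(q-1).  Comparing
degrees in theta shows that q (q-1) divides |Gal (L / E)|
([degree_geometric_extension]). *)

Set Implicit Arguments.
Unset Strict Implicit.
Unset Printing Implicit Defensive.
Import GRing.Theory.
Local Open Scope ring_scope.

(** * Finite fields and their embeddings *)

Lemma Fp_rmorph_unique p (R : nzRingType) (phi psi : {rmorphism 'F_p -> R}) :
  phi =1 psi.
Proof. by move=> k; rewrite -[k]natr_Zp !rmorph_nat. Qed.

Lemma Fp_rmorph_exists p (R : nzRingType) :
  p \in [pchar R] -> inhabited {rmorphism 'F_p -> R}.
Proof.
move=> chR; constructor.
pose E := pPrimeCharType chR.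
exact: (GRing.in_alg E : {rmorphism 'F_p -> E}).
Qed.

Section FiniteField.

Variable F : finFieldType.

Lemma finField_generator :
  {g : F | g != 0 & forall z : F, z != 0 -> exists k, z = g ^+ k}.
Proof.
have F_gt1 := finNzRing_gt1 F.
have q1_gt0 : (0 < #|F|.-1)%N by rewrite -subn1 subn_gt0.
pose rs := [seq z <- enum F | z != 0].
have unity_rs (z : F) : z != 0 -> z ^+ #|F|.-1 = 1.
  move=> z0; apply: (mulfI z0).
  by rewrite mulr1 -exprS prednK ?expf_card // ltnW.
have rsP : all #|F|.-1.-unity_root rs.
  apply/allP=> z; rewrite mem_filter => /andP[z0 _].
  by apply/unity_rootP/unity_rs.
have size_rs : (#|F|.-1 <= size rs)%N.
  by rewrite -(cardC1 (0 : F)) cardE /enum_mem -enumT.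
have /(has_prim_root q1_gt0 rsP)/(_ size_rs)/hasP/sig2W[g] : uniq rs.
  exact: filter_uniq (enum_uniq _).
rewrite mem_filter => /andP[g0 _] prim_g; exists g => // z z0.
by have [i ->] := prim_rootP prim_g (unity_rs z z0); exists i.
Qed.

Variables (p n : nat) (p_prime : prime p) (card_F : #|F| = (p ^ n)%N).
Variable phi : {rmorphism 'F_p -> F}.

(** The degree bound holds since F has dimension n over F_p.  The polynomial is
given over 'F_p, with an arbitrary morphism to F, so that it can be evaluated
in other fields of characteristic p. *)
Lemma finField_minpoly (g : F) :
  exists f : {poly 'F_p}, [/\ f != 0, (size f <= n.+1)%N &
    forall h, root (map_poly phi h) g = (f %| h)].
Proof.
have chF := card_finPcharP card_F p_prime.
pose E := (pPrimeCharType chF : splittingFieldType 'F_p).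
have phiE : phi =1 (GRing.in_alg E : {rmorphism 'F_p -> E}).
  exact: Fp_rmorph_unique.
have /polyOver1P[f Df] := minPolyOver 1%AS (g : E).
have monic_f : f \is monic.
  by rewrite -(map_monic (GRing.in_alg E)) -Df monic_minPoly.
exists f; split; first exact: monic_neq0.
- rewrite -(size_map_poly (GRing.in_alg E)) -Df size_minPoly ltnS.
  have := dim_Fadjoin 1%AS (g : E); rewrite dimv1 muln1 => <-.
  suff <- : \dim {:E} = n by rewrite dimvS ?subvf.
  by rewrite pprimeChar_dimf card_F pfactorK.
- move=> h; rewrite (eq_map_poly phiE) -(dvdp_map (GRing.in_alg E)) -Df.
  apply/idP/idP=> [rh | dv].
    by apply: (@minPoly_dvdp _ E) => //; apply/polyOver1P; exists h.
  by rewrite -[root _ _]dvdp_XsubCl; apply: dvdp_trans dv;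
     rewrite dvdp_XsubCl root_minPoly.
Qed.

(** The Euclidean division of X^k by m expresses every power of g as a
polynomial in g of degree less than that of m. *)
Lemma finField_card_generated (g : F) (m : {poly 'F_p}) :
    (forall z : F, z != 0 -> exists k, z = g ^+ k) ->
  m != 0 -> root (map_poly phi m) g -> (#|F| <= p ^ (size m).-1)%N.
Proof.
move=> gen_g m0 /eqP mg.
pose ev (v : 'rV['F_p]_(size m).-1) := (map_poly phi (rVpoly v)).[g].
have /fin_all_exists[c cP] (z : F) : exists v, ev v = z.
  have [->|/gen_g[k ->]] := eqVneq z 0.
    by exists 0; rewrite /ev linear0 rmorph0 horner0.
  exists (poly_rV ('X^k %% m)); rewrite /ev poly_rV_K; last first.
    by rewrite -ltnS prednK ?lt0n ?size_poly_eq0 // ltn_modp.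
  transitivity (map_poly phi 'X^k).[g]; last first.
    by rewrite map_polyXn hornerXn.
  by rewrite [in RHS](divp_eq 'X^k m) rmorphD rmorphM hornerD hornerM mg
             mulr0 add0r.
by have /leq_card := can_inj cP; rewrite card_mx card_Fp // mul1n.
Qed.

(** Modulo P there are only finitely many polynomials over F, so two powers of G
are congruent.  If the powers of G (theta) are distinct, theta is therefore
transcendental over F. *)
Lemma algebraic_powers_repeat (L : fieldType) (iota : {rmorphism F -> L})
    (theta : L) (P G : {poly F}) :
    P != 0 -> root (map_poly iota P) theta ->
  exists i j, (i < j)%N /\
    (map_poly iota G).[theta] ^+ i = (map_poly iota G).[theta] ^+ j.
Proof.
move=> P0 /eqP Pt.
pose N := #|{: 'rV[F]_(size P).-1}|.
pose rem (i : 'I_N.+1) := poly_rV (G ^+ i %% P) : 'rV[F]_(size P).-1.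
have remE i : (map_poly iota (rVpoly (rem i))).[theta]
            = (map_poly iota G).[theta] ^+ i.
  rewrite poly_rV_K; last first.
    by rewrite -ltnS prednK ?lt0n ?size_poly_eq0 // ltn_modp.
  rewrite -horner_exp -rmorphXn [in RHS](divp_eq (G ^+ i) P).
  by rewrite rmorphD rmorphM hornerD hornerM Pt mulr0 add0r.
have /injectivePn[i [j neq_ij eq_ij]] : ~~ injectiveb rem.
  by apply/negP=> /injectiveP/leq_card; rewrite card_ord ltnn.
have eq_pow : (map_poly iota G).[theta] ^+ i = (map_poly iota G).[theta] ^+ j.
  by rewrite -!remE eq_ij.
have [lt_ij|lt_ji|/val_inj/eqP] := ltngtP i j.
- by exists i, j.
- by exists j, i.
- by rewrite (negPf neq_ij).
Qed.

(** The minimal polynomial f of a generator g divides X^q - X, hence has a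
root w in L; a polynomial expression in g is sent to the same expression in w.
*)
Lemma finField_embedding (L : fieldType) (psi : {rmorphism 'F_p -> L})
    (rs : seq L) :
    'X^#|F| - 'X %| \prod_(r <- rs) ('X - r%:P) ->
  inhabited {rmorphism F -> L}.
Proof.
move=> splits.
have [g g0 gen_g] := finField_generator.
have [f [f0 _ f_min]] := finField_minpoly g.
have f_gt1 : (size f != 1)%N.
  apply/negP=> /size_poly1P[c c0 Df].
  have := f_min f; rewrite dvdpp Df map_polyC /root hornerC fmorph_eq0.
  by rewrite (negPf c0).
have f_dvd : f %| 'X^#|F| - 'X.
  rewrite -f_min rmorphB /= map_polyXn map_polyX /root !hornerE.
  by rewrite expf_card subrr.
have [w fw] : exists w, root (map_poly psi f) w.
  have : map_poly psi f %| \prod_(r <- rs) ('X - r%:P).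
    apply: dvdp_trans splits; rewrite -(dvdp_map psi) in f_dvd.
    by rewrite rmorphB /= map_polyXn map_polyX in f_dvd.
  case/(@dvdp_prod_XsubC _ _ _ id) => m f_eq.
  case Dm: (mask m rs) f_eq => [|w s] f_eq.
    move/eqp_size: f_eq; rewrite big_nil size_poly1 size_map_poly => /eqP.
    by rewrite (negPf f_gt1).
  exists w; rewrite (eqp_root f_eq) big_cons rootM root_XsubC eqxx //.
have vanish h : root (map_poly phi h) g -> (map_poly psi h).[w] = 0.
  rewrite f_min -(dvdp_map psi) => /dvdpP[k ->].
  by rewrite hornerM (eqP fw) mulr0.
have /fin_all_exists[c cP] (z : F) : exists h, (map_poly phi h).[g] = z.
  have [->|/gen_g[k ->]] := eqVneq z 0.
    by exists 0; rewrite rmorph0 horner0.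
  by exists 'X^k; rewrite map_polyXn hornerXn.
(* Independence of the choice of c makes emb a morphism. *)
pose emb z := (map_poly psi (c z)).[w].
have embE h : (map_poly psi h).[w] = emb (map_poly phi h).[g].
  apply/eqP; rewrite -subr_eq0 -hornerN -hornerD -rmorphB; apply/eqP/vanish.
  by rewrite /root rmorphB hornerD hornerN cP subrr.
have embB : zmod_morphism emb.
  move=> y z; rewrite -{1}(cP y) -{1}(cP z) -hornerN -hornerD -rmorphB -embE.
  by rewrite rmorphB hornerD hornerN.
have embM : monoid_morphism emb.
  split=> [|y z]; last first.
    by rewrite -{1}(cP y) -{1}(cP z) -hornerM -rmorphM -embE rmorphM hornerM.
  have := embE 1; rewrite !rmorph1 !hornerC => <- //.
pose mB := GRing.isZmodMorphism.Build F L emb embB.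
pose mM := GRing.isMonoidMorphism.Build F L emb embM.
constructor; exact: (HB.pack_for {rmorphism F -> L} emb mB mM).
Qed.

End FiniteField.

(** * The automorphisms of the affine group *)

Section AffineGroup.

Variable F : finFieldType.
Implicit Types (a b c d : F) (s t : {perm F}).

Fact affine_subproof a b :
  injective (fun x => (if a == 0 then 1 else a) * x + b).
Proof.
move=> x y /addIr; apply: mulfI.
by case: ifPn; rewrite ?oner_neq0.
Qed.

(** Replacing the slope 0 by 1 makes this a permutation for all a and b. *)
Definition affine a b : {perm F} := perm (@affine_subproof a b).
Arguments affine (a b)%_ring_scope.

Lemma affineE a b x : a != 0 -> affine a b x = a * x + b.
Proof. by move=> a0; rewrite permE (negPf a0). Qed.

Lemma mem_affine a b : a != 0 -> affine a b \in AGL1 F.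
Proof.
by move=> a0; apply/AGL1P; exists a, b; split=> // x; apply: affineE.
Qed.

Lemma affineP s :
  reflect (exists a b, a != 0 /\ s = affine a b) (s \in AGL1 F).
Proof.
apply: (iffP idP) => [/AGL1P[a [b [a0 sE]]] | [a [b [a0 ->]]]].
  by exists a, b; split=> //; apply/permP=> x; rewrite sE affineE.
exact: mem_affine.
Qed.

Lemma affine_eq a b c d :
  a != 0 -> c != 0 -> affine a b = affine c d -> a = c /\ b = d.
Proof.
move=> a0 c0 eq_s.
have eqx x : a * x + b = c * x + d by rewrite -!affineE ?eq_s.
have eq_bd : b = d by have := eqx 0; rewrite !mulr0 !add0r.
by split=> //; have := eqx 1; rewrite !mulr1 eq_bd => /addIr.
Qed.

Lemma affine10 : affine 1 0 = 1%g.
Proof. by apply/permP=> x; rewrite affineE ?oner_neq0 // perm1 mul1r addr0. Qed.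

Lemma affineM a b c d : a != 0 -> c != 0 ->
  (affine a b * affine c d)%g = affine (c * a) (c * b + d).
Proof.
move=> a0 c0; apply/permP=> x.
by rewrite permM !affineE ?mulf_neq0 // mulrDr mulrA addrA.
Qed.

Lemma affineX a b k :
  a != 0 -> exists b', (affine a b ^+ k)%g = affine (a ^+ k) b'.
Proof.
move=> a0; elim: k => [|k [b' IH]]; first by exists 0; rewrite expr0 affine10.
by exists (a * b' + b); rewrite expgSr IH affineM ?expf_neq0 // -exprS.
Qed.

Lemma scalingX a k : a != 0 -> (affine a 0 ^+ k)%g = affine (a ^+ k) 0.
Proof.
move=> a0; elim: k => [|k IH]; first by rewrite expr0 affine10.
by rewrite expgSr IH affineM ?expf_neq0 // -exprS mulr0 addr0.
Qed.

Lemma translationX b k : (affine 1 b ^+ k)%g = affine 1 (b *+ k).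
Proof.
elim: k => [|k IH]; first by rewrite mulr0n affine10.
by rewrite expgSr IH affineM ?oner_neq0 // !mul1r mulrSr.
Qed.

Lemma translationJ a b d : a != 0 ->
  (affine 1 b ^ affine a d)%g = affine 1 (a * b).
Proof.
move=> a0; apply: (mulgI (affine a d)).
rewrite -conjgC !affineM ?oner_neq0 //.
by rewrite mulr1 !mul1r addrC.
Qed.

(** A permutation commuting with a scaling x |-> a x, where a is neither 0 nor
1, fixes the unique fixed point 0 of that scaling; commuting with
translations, it then fixes every point. *)
Lemma cent_AGL1 : (2 < #|F|)%N -> 'C(AGL1 F)%g = 1%g.
Proof.
move=> F_gt2; apply/trivgP/subsetP=> s /centP cs; apply/set1gP.
have comm a b x : a != 0 -> s (a * x + b) = a * s x + b.
  by move=> a0; rewrite -!affineE // -!permM (cs _ (mem_affine b a0)).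
have s0 : s 0 = 0.
  pose S : {set F} := [set 0; 1].
  have /card_gt0P[a] : (0 < #|~: S|)%N.
    rewrite -(ltn_add2l #|S|) cardsC addn0 cards2.
    by apply: leq_ltn_trans F_gt2; case: (_ != _).
  rewrite !inE negb_or => /andP[a0 a1].
  have /eqP := comm a 0 0 a0; rewrite mulr0 !addr0 -{1}[s 0]mul1r -subr_eq0.
  by rewrite -mulrBl mulf_eq0 subr_eq0 eq_sym (negPf a1) => /eqP.
apply/permP=> x; have := comm 1 x 0 (oner_neq0 _).
by rewrite mulr0 add0r s0 mulr0 add0r perm1.
Qed.

Section AutBound.

Variables (p n : nat) (p_prime : prime p) (card_F : #|F| = (p ^ n)%N).

(** The slope a satisfies a^p = 1, and a = a^q is a power of a^p. *)
Lemma AGL1_torsion s :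
  s \in AGL1 F -> (s ^+ p = 1)%g -> exists b, s = affine 1 b.
Proof.
case/affineP=> a [b [a0 ->]]; have [b' ->] := affineX b p a0.
rewrite -affine10 => /affine_eq[||ap _]; rewrite ?expf_neq0 ?oner_neq0 //.
exists b; congr affine; rewrite -(expf_card a) card_F.
have n_gt0 : (0 < n)%N.
  by case: n card_F (finNzRing_gt1 F) => // ->.
by rewrite -(prednK n_gt0) expnS exprM ap expr1n.
Qed.

Variable g : F.
Hypotheses (g0 : g != 0) (gen_g : forall z : F, z != 0 -> exists k, z = g ^+ k).
Variables (phi : {rmorphism 'F_p -> F}) (f : {poly 'F_p}).
Hypotheses (f0 : f != 0) (size_f : (size f <= n.+1)%N).
Hypothesis f_g : root (map_poly phi f) g.

Lemma Aut_AGL1_translation (alpha : {perm {perm F}}) :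
    alpha \in Aut (AGL1 F) ->
  exists lam : F -> F, forall b, alpha (affine 1 b) = affine 1 (lam b).
Proof.
move=> Aalpha; have chF := card_finPcharP card_F p_prime.
apply: (fin_all_exists (P := fun b c => alpha (affine 1 b) = affine 1 c)) => b.
apply: AGL1_torsion; first by rewrite Aut_closed ?mem_affine ?oner_neq0.
rewrite -(autmE Aalpha) -morphX ?mem_affine ?oner_neq0 //.
by rewrite translationX (mulrn_pchar chF) affine10 morph1.
Qed.

(** Let lam describe alpha on translations.  It is additive, hence F_p-linear,
and conjugating translations by the scaling of ratio g gives lam (g^k) = a^k *
lam 1.  Applying lam to f (g) = 0 yields f (a) * lam 1 = 0. *)
Lemma Aut_AGL1_scaling (alpha : {perm {perm F}}) :
    alpha \in Aut (AGL1 F) ->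
  exists2 a, a != 0 & root (map_poly phi f) a /\
    exists b, alpha (affine g 0) = affine a b.
Proof.
move=> Aalpha; have chF := card_finPcharP card_F p_prime.
have oner0 := oner_neq0 F.
have [lam lamE] := Aut_AGL1_translation Aalpha.
have /affineP[a [b [a0 alphag]]] : alpha (affine g 0) \in AGL1 F.
  by rewrite Aut_closed ?mem_affine.
exists a => //; split; last by exists b.
have lamD b1 b2 : lam (b1 + b2) = lam b1 + lam b2.
  have : alpha (affine 1 b1 * affine 1 b2)%g
       = (alpha (affine 1 b1) * alpha (affine 1 b2))%g.
    by rewrite -(autmE Aalpha) morphM ?mem_affine.
  by rewrite affineM // !mul1r !lamE affineM // !mul1r => /affine_eq[].
have lam0 : lam 0 = 0 by apply: (addrI (lam 0)); rewrite -lamD !addr0.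
have lamMn c k : lam (c *+ k) = lam c *+ k.
  by elim: k => [|k IH]; rewrite ?mulr0n // !mulrS lamD IH.
have lam_g k : lam (g ^+ k) = a ^+ k * lam 1.
  have : alpha (affine 1 1 ^ (affine g 0 ^+ k))%g
       = (alpha (affine 1 1) ^ (alpha (affine g 0) ^+ k))%g.
    by rewrite -(autmE Aalpha) morphJ ?morphX ?groupX ?mem_affine.
  rewrite scalingX // translationJ ?expf_neq0 // mulr1 !lamE alphag.
  have [b' ->] := affineX b k a0.
  by rewrite translationJ ?expf_neq0 // => /affine_eq[].
have lam1 : lam 1 != 0.
  apply/eqP=> lam1; have : alpha (affine 1 1) = alpha (affine 1 0).
    by rewrite !lamE lam1 lam0.
  by move/perm_inj/affine_eq => [] // _ /eqP; rewrite (negPf oner0).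
apply/eqP/(mulIf lam1); rewrite mul0r -[RHS]lam0 -(eqP f_g).
rewrite !horner_coef (big_morph lam lamD lam0) mulr_suml !size_map_poly.
apply: eq_bigr => i _; rewrite !coef_map /= -[f`_i]natr_Zp !rmorph_nat.
by rewrite !mulr_natl lamMn lam_g mulrnAl.
Qed.

(** The scaling of ratio g and the translation by 1 generate the affine group:
conjugating that translation by powers of the scaling gives all others. *)
Lemma Aut_AGL1_eq (alpha beta : {perm {perm F}}) :
    alpha \in Aut (AGL1 F) -> beta \in Aut (AGL1 F) ->
    alpha (affine g 0) = beta (affine g 0) ->
    alpha (affine 1 1) = beta (affine 1 1) ->
  alpha = beta.
Proof.
move=> Aa Ab eq_g eq_1; have oner0 := oner_neq0 F.
have eq_scal c : c != 0 -> alpha (affine c 0) = beta (affine c 0).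
  case/gen_g=> k ->; rewrite -scalingX //.
  by rewrite -(autmE Aa) -(autmE Ab) !morphX ?mem_affine //= !autmE eq_g.
have eq_tr b : alpha (affine 1 b) = beta (affine 1 b).
  have [->|b0] := eqVneq b 0.
    by rewrite affine10 -(autmE Aa) -(autmE Ab) !morph1.
  rewrite -[b]mulr1 -(translationJ _ 0) //.
  rewrite -(autmE Aa) -(autmE Ab) !morphJ ?mem_affine //= !autmE.
  by rewrite eq_1 eq_scal.
apply: (eq_Aut Aa Ab) => s /affineP[c [b [c0 ->]]].
have -> : affine c b = (affine c 0 * affine 1 b)%g.
  by rewrite affineM // mul1r mulr0 add0r.
rewrite -(autmE Aa) -(autmE Ab) !morphM ?mem_affine //= !autmE.
by rewrite eq_scal ?eq_tr.
Qed.

(** There are n q possible images for the scaling and q - 1 for the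
translation. *)
Lemma card_Aut_AGL1_le_aux : (#|Aut (AGL1 F)| <= n * #|F| * #|F|.-1)%N.
Proof.
have oner0 := oner_neq0 F.
pose Z := [set z | root (map_poly phi f) z].
have card_Z : (#|Z| <= n)%N.
  rewrite cardE -ltnS (leq_trans _ size_f) // -(size_map_poly phi f).
  apply: max_poly_roots (enum_uniq _); first by rewrite map_poly_eq0.
  by apply/allP=> z; rewrite mem_enum inE.
pose X := [set affine z.1 z.2 | z in setX Z [set: F]].
pose Y := [set affine 1 c | c in [set~ (0 : F)]].
pose h (alpha : {perm {perm F}}) := (alpha (affine g 0), alpha (affine 1 1)).
have h_inj : {in Aut (AGL1 F) &, injective h}.
  by move=> alpha beta Aa Ab [eqg eq1]; apply: Aut_AGL1_eq.
rewrite -(card_in_imset h_inj); apply: (@leq_trans #|setX X Y|).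
  apply/subset_leq_card/subsetP=> _ /imsetP[alpha Aa ->].
  have [a a0 [fa [b alphag]]] := Aut_AGL1_scaling Aa.
  have [lam lamE] := Aut_AGL1_translation Aa.
  rewrite inE /= alphag lamE; apply/andP; split.
    by apply/imsetP; exists (a, b); rewrite // !inE fa.
  apply: imset_f; rewrite !inE; apply: contraNneq (oner0) => lam1.
  have : alpha (affine 1 1) = alpha (affine 1 0).
    by rewrite lamE lam1 affine10 -(autmE Aa) morph1.
  by move/perm_inj/affine_eq => [] // _ ->.
rewrite cardsX leq_mul //; apply: leq_trans (leq_imset_card _ _) _.
  by rewrite cardsX cardsT leq_mul.
by rewrite cardsC1.
Qed.

End AutBound.

Lemma card_Aut_AGL1_le (p n : nat) : prime p -> #|F| = (p ^ n)%N ->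
  (#|Aut (AGL1 F)| <= n * #|F| * #|F|.-1)%N.
Proof.
move=> p_prime card_F.
have [phi] := Fp_rmorph_exists (card_finPcharP card_F p_prime).
have [g g0 gen_g] := finField_generator F.
have [f [f0 size_f f_min]] := finField_minpoly p_prime card_F phi g.
have f_g : root (map_poly phi f) g by rewrite f_min.
exact: (card_Aut_AGL1_le_aux p_prime card_F g0 gen_g f0 size_f f_g).
Qed.

End AffineGroup.

(** * The roots of B *)

(** The polynomial T with B = T - x, so that x = T (theta) for a root theta of
B. *)
Definition artin_power (R : nzRingType) (q : nat) : {poly R} :=
  ('X^q - 'X) ^+ q.-1.

Lemma map_artin_power (R S : nzRingType) (f : {rmorphism R -> S}) q :
  map_poly f (artin_power R q) = artin_power S q.
Proof. by rewrite rmorphXn rmorphB /= map_polyXn map_polyX. Qed.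

Lemma size_artin_power (R : fieldType) q :
  (1 < q)%N -> (size (artin_power R q)).-1 = (q * q.-1)%N.
Proof.
move=> q_gt1; rewrite size_exp size_polyDl size_polyXn //.
by rewrite size_polyN size_polyX ltnS.
Qed.

Lemma size_artin_power_gt1 (R : fieldType) q :
  (1 < q)%N -> (1 < size (artin_power R q))%N.
Proof.
move=> q_gt1; have : (1 < q * q.-1)%N.
  by rewrite (leq_trans q_gt1) // leq_pmulr // -ltnS prednK // ltnW.
by rewrite -(size_artin_power R q_gt1); case: (size _) => [|[|k]].
Qed.

Section Torsor.

Variables (L : fieldType) (q : nat) (x theta : L).
Hypotheses (q_gt1 : (1 < q)%N) (charL : [pchar L].-nat q).
Hypothesis theta_root : (theta ^+ q - theta) ^+ q.-1 = x.

(** With u = theta^q - theta, the translate of B by theta is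
(X^q - X + u)^(q-1) - u^(q-1), which is divisible by X^q - X. *)
Lemma splits_translate (rs : seq L) :
    artin_power L q - x%:P %= \prod_(r <- rs) ('X - r%:P) ->
  'X^q - 'X %| \prod_(r <- [seq r - theta | r <- rs]) ('X - r%:P).
Proof.
move=> eqB; have charP : [pchar {poly L}].-nat q.
  by apply: etrans charL; apply: eq_pnat => l; rewrite pchar_poly.
have -> : \prod_(r <- [seq r - theta | r <- rs]) ('X - r%:P)
        = (\prod_(r <- rs) ('X - r%:P)) \Po ('X + theta%:P).
  rewrite big_map rmorph_prod; apply: eq_bigr => r _ /=.
  by rewrite comp_polyB comp_polyX comp_polyC polyCB opprB addrA addrAC.
have dvB : artin_power L q - x%:P %| \prod_(r <- rs) ('X - r%:P).
  by rewrite -(eqp_dvdr _ eqB).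
apply: dvdp_trans (dvdp_comp_poly ('X + theta%:P) dvB).
rewrite comp_polyB comp_polyC /artin_power rmorphXn rmorphB rmorphXn /=.
rewrite comp_polyX (exprDn_pchar _ _ charP) -theta_root.
rewrite !(polyC_exp, polyCB) subrXX.
by rewrite opprD addrACA addrK dvdp_mulIl.
Qed.

(** A weak form of the transcendence of x over the prime field; since F is
finite it already makes theta transcendental over F. *)
Hypothesis x_powers : forall i j, x ^+ i = x ^+ j -> i = j.

Lemma torsor_neq0 : theta ^+ q - theta != 0.
Proof.
apply/eqP=> S0; have : x ^+ 1 = x ^+ 2.
  rewrite -theta_root S0 expr0n -subn1 subn_eq0 leqNgt q_gt1 /=.
  by rewrite mulr0n !expr0n.
by move/x_powers.
Qed.

Variable F : finFieldType.
Hypothesis card_F : #|F| = q.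
Variable iota : {rmorphism F -> L}.

Lemma fixed_pow_image w : w ^+ q = w -> exists z, w = iota z.
Proof.
move=> wq; have : root (map_poly iota ('X^q - 'X)) w.
  by rewrite rmorphB /= map_polyXn map_polyX /root !hornerE wq subrr.
rewrite -card_F finField_genPoly map_prod_XsubC.
rewrite -(big_map iota xpredT (fun a => 'X - a%:P)) root_prod_XsubC.
by case/mapP=> z _ ->; exists z.
Qed.

Lemma iota_pow z : iota z ^+ q = iota z.
Proof. by rewrite -rmorphXn -card_F expf_card. Qed.

Lemma theta_transcendental (P : {poly F}) :
  (map_poly iota P).[theta] = 0 -> P = 0.
Proof.
move=> Pt; apply: contraTeq isT => P0; exfalso.
have /eqP rootP := Pt.
have [i [j [lt_ij]]] := algebraic_powers_repeat (artin_power F q) P0 rootP.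
rewrite map_artin_power horner_exp !hornerE theta_root => /x_powers eq_ij.
by rewrite eq_ij ltnn in lt_ij.
Qed.

Lemma poly_theta_inj (P Q : {poly F}) :
  (map_poly iota P).[theta] = (map_poly iota Q).[theta] -> P = Q.
Proof.
move=> eqPQ; apply/eqP; rewrite -subr_eq0; apply/eqP/theta_transcendental.
by rewrite rmorphB hornerD hornerN eqPQ subrr.
Qed.

Lemma horner_artin_comp (P : {poly F}) :
  (map_poly iota P).[x] = (map_poly iota (P \Po artin_power F q)).[theta].
Proof.
rewrite map_comp_poly horner_comp map_artin_power.
by rewrite horner_exp !hornerE theta_root.
Qed.

Lemma poly_x_inj (P Q : {poly F}) :
  (map_poly iota P).[x] = (map_poly iota Q).[x] -> P = Q.
Proof.
rewrite !horner_artin_comp => /poly_theta_inj/eqP.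
rewrite -subr_eq0 -rmorphB comp_poly_eq0 ?subr_eq0 => [/eqP//|].
exact: (size_artin_power_gt1 F q_gt1).
Qed.

Lemma affine_theta_inj a b c d :
  iota a * theta + iota b = iota c * theta + iota d -> a = c /\ b = d.
Proof.
move=> eq_ab; have : a%:P * 'X + b%:P = c%:P * 'X + d%:P.
  apply: poly_theta_inj.
  by rewrite !rmorphD !rmorphM /= map_polyX !map_polyC !hornerE.
move=> eqP; split.
  have := congr1 (fun P : {poly F} => P`_1) eqP.
  by rewrite !coefE /= !addr0 !mulr1.
have := congr1 (fun P : {poly F} => P`_0) eqP.
by rewrite !coefE /= !mulr0 !add0r.
Qed.

(** The quotient alpha of theta'^q - theta' by theta^q - theta satisfies
alpha^(q-1) = 1, so it lies in F, and then theta' - alpha * theta is fixed by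
the q-th power map. *)
Lemma root_affine theta' :
    (theta' ^+ q - theta') ^+ q.-1 = x ->
  exists a b, a != 0 /\ theta' = iota a * theta + iota b.
Proof.
move=> root'; have u0 := torsor_neq0.
pose alpha := (theta' ^+ q - theta') / (theta ^+ q - theta).
have alpha1 : alpha ^+ q.-1 = 1.
  by rewrite expr_div_n root' theta_root divff // -theta_root expf_neq0.
have alphaq : alpha ^+ q = alpha.
  by rewrite -[in LHS](ltn_predK q_gt1) exprS alpha1 mulr1.
have [a Da] := fixed_pow_image alphaq.
have a0 : a != 0.
  rewrite -(fmorph_eq0 iota) -Da; apply: contra_eqN alpha1 => /eqP->.
  by rewrite expr0n -subn1 subn_eq0 leqNgt q_gt1 /= eq_sym oner_eq0.
have [|b Db] := @fixed_pow_image (theta' - alpha * theta).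
  rewrite exprDn_pchar // exprNn_pchar // exprMn alphaq.
  have : alpha * (theta ^+ q - theta) = theta' ^+ q - theta' by apply: divfK.
  by rewrite mulrBr => /(canRL (subrK _))->; ring.
by exists a, b; split=> //; rewrite -Da -Db addrC subrK.
Qed.

(** The elements theta - iota z represent, up to scalars in F, the polynomials
of degree one in theta; an automorphism permutes them, and s records how.
Forgetting the scalar c makes s compatible with composition even though
automorphisms move F. *)
Definition induces (sigma : L -> L) (s : {perm F}) : Prop :=
  forall z, exists2 c, c != 0 &
    sigma (theta - iota z) = iota c * (theta - iota (s z)).

Lemma line_inj c d z w : c != 0 ->
  iota c * (theta - iota z) = iota d * (theta - iota w) -> c = d /\ z = w.
Proof.
move=> c0; rewrite !mulrBr -!rmorphM -!rmorphN => /affine_theta_inj[<-].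
by move/oppr_inj/(mulfI c0).
Qed.

Lemma induces_unique sigma s t : induces sigma s -> induces sigma t -> s = t.
Proof.
move=> Is It; apply/permP=> z; have [c c0 Dc] := Is z; have [d d0 Dd] := It z.
by have [] := line_inj c0 (etrans (esym Dc) Dd).
Qed.

Section Sigma.

Variable sigma : {rmorphism L -> L}.
Hypothesis sigma_x : sigma x = x.

Lemma sigma_iota z : exists w, sigma (iota z) = iota w.
Proof. by apply: fixed_pow_image; rewrite -rmorphXn iota_pow. Qed.

(** If sigma theta = a theta + b and sigma acts on F as the field automorphism
tau, then s z = (tau z - b) / a.  Conjugation by s turns c x + d into tau c *
x + e, where e = (tau c * b + tau d - b) / a. *)
Lemma induces_exists :
  exists2 s : {perm F}, s \in 'N(AGL1 F)%g & induces sigma s.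
Proof.
have [tau tauE] := fin_all_exists sigma_iota.
have [|a [b [a0 Dtheta]]] := @root_affine (sigma theta).
  by rewrite -rmorphXn -rmorphB -rmorphXn theta_root.
have tau_inj : injective tau.
  move=> y z eq_yz; apply: (fmorph_inj iota); apply: (fmorph_inj sigma).
  by rewrite !tauE eq_yz.
have tauD y z : tau (y + z) = tau y + tau z.
  by apply: (fmorph_inj iota); rewrite rmorphD -!tauE !rmorphD.
have tauM y z : tau (y * z) = tau y * tau z.
  by apply: (fmorph_inj iota); rewrite rmorphM -!tauE !rmorphM.
have s_inj : injective (fun z => (tau z - b) / a).
  by move=> y z /(mulIf (invr_neq0 a0))/addIr/tau_inj.
pose s := perm s_inj.
have sE z : a * s z + b = tau z by rewrite permE mulrC divfK // subrK.
exists s; last first.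
  move=> z; exists a => //; rewrite rmorphB tauE Dtheta -sE.
  by rewrite mulrBr rmorphD rmorphM opprD addrACA subrr addr0.
rewrite inE; apply/subsetP=> _ /imsetP[_ /affineP[c [d [c0 ->]]] ->].
have tauc0 : tau c != 0.
  apply: contraNneq c0 => tauc; rewrite -(inj_eq tau_inj) tauc eq_sym.
  by apply/eqP/(addrI (tau 0)); rewrite -tauD !addr0.
apply/affineP; exists (tau c), ((tau c * b + tau d - b) / a); split=> //.
apply/permP=> w; rewrite -[w](permKV s) permJ !affineE //.
apply: (mulfI a0); apply: (addIr b); rewrite sE tauD tauM -[tau (_ w)]sE permKV.
by field.
Qed.

End Sigma.

Lemma induces_comp (sigma rho : {rmorphism L -> L}) (s t : {perm F}) :
    induces sigma s -> induces rho t ->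
  induces (rho \o sigma) (s * t)%g.
Proof.
move=> Is It z; have [c c0 Dc] := Is z; have [d d0 Dd] := It (s z).
have [w Dw] := sigma_iota rho c.
have w0 : w != 0 by rewrite -(fmorph_eq0 iota) -Dw !fmorph_eq0.
exists (w * d); first by rewrite mulf_neq0.
by rewrite /= Dc rmorphM Dd Dw permM rmorphM mulrA.
Qed.

(** Evaluation at z = 0 and z = 1 gives sigma theta = theta; comparing
coefficients in sigma (theta - iota z) then shows that sigma fixes F. *)
Lemma induces_id (sigma : {rmorphism L -> L}) : induces sigma 1%g ->
  sigma theta = theta /\ forall z, sigma (iota z) = iota z.
Proof.
move=> I1; have [c c0 Dc] := I1 0; have [d d0 Dd] := I1 1.
move: Dc Dd; rewrite !perm1 !rmorphB !rmorph1 !rmorph0 !subr0 => Dc Dd.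
have /affine_theta_inj[eq_cd /oppr_inj d1] :
    iota c * theta + iota (- 1) = iota d * theta + iota (- d).
  by rewrite !rmorphN rmorph1 -Dc Dd; ring.
rewrite eq_cd -d1 rmorph1 mul1r in Dc; split=> // z.
have [w Dw] := sigma_iota sigma z; have [e e0] := I1 z.
rewrite rmorphB Dc perm1 Dw => De.
have /affine_theta_inj[e1 /oppr_inj->] :
    iota 1 * theta + iota (- w) = iota e * theta + iota (- (e * z)).
  by rewrite !rmorphN rmorphM rmorph1 mul1r De; ring.
by rewrite -e1 mul1r.
Qed.

(** Membership in the subfield F(x), with cleared denominators. *)
Definition in_Fx (y : L) : Prop := exists2 D : {poly F}, D != 0 &
  exists C : {poly F}, y * (map_poly iota D).[x] = (map_poly iota C).[x].

Lemma in_Fx_iota a : in_Fx (iota a).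
Proof.
exists 1; first exact: oner_neq0.
by exists a%:P; rewrite rmorph1 map_polyC !hornerC mulr1.
Qed.

Lemma in_FxD y z : in_Fx y -> in_Fx z -> in_Fx (y + z).
Proof.
case=> [D D0 [C DC]] [E E0 [G EG]]; exists (D * E); first by rewrite mulf_neq0.
exists (C * E + G * D); rewrite !rmorphD !rmorphM hornerD !hornerM -DC -EG /=.
by ring.
Qed.

Lemma in_FxM y z : in_Fx y -> in_Fx z -> in_Fx (y * z).
Proof.
case=> [D D0 [C DC]] [E E0 [G EG]]; exists (D * E); first by rewrite mulf_neq0.
by exists (C * G); rewrite !rmorphM !hornerM -DC -EG /= mulrACA.
Qed.

Lemma in_Fx_horner (P : {poly L}) y :
  (forall i, in_Fx P`_i) -> in_Fx y -> in_Fx P.[y].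
Proof.
move=> PFx yFx; rewrite horner_coef.
elim/big_ind: _ => [|u v|i _].
  by rewrite -(rmorph0 iota); apply: in_Fx_iota.
  exact: in_FxD.
apply: in_FxM => //; elim: (i : nat) => [|k IH].
  by rewrite expr0 -(rmorph1 iota); apply: in_Fx_iota.
by rewrite exprS; apply: in_FxM.
Qed.

(** If h (theta) = C (x) / D (x), then h * D (T) = C (T) as polynomials, where
T is the polynomial of degree q (q-1) whose value at theta is x. *)
Lemma degree_in_Fx (h : {poly F}) : in_Fx (map_poly iota h).[theta] ->
  (q * q.-1 %| (size h).-1)%N.
Proof.
case=> [D D0 [C]]; rewrite !horner_artin_comp -hornerM -rmorphM.
move/poly_theta_inj => eqC.
have [->|h0] := eqVneq h 0; first by rewrite size_poly0.
have T_gt1 := (size_artin_power_gt1 F q_gt1).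
have DT0 : D \Po artin_power F q != 0 by rewrite comp_poly_eq0.
have sC := size_comp_poly C (artin_power F q).
have sD := size_comp_poly D (artin_power F q).
rewrite size_artin_power // in sC sD.
rewrite -(dvdn_addl _ (dvdn_mull (size D).-1 (dvdnn (q * q.-1)))) -sD.
suff -> : ((size h).-1 + (size (D \Po artin_power F q)).-1
          = (size (C \Po artin_power F q)).-1)%N.
  by rewrite sC dvdn_mull.
by rewrite -eqC size_mul // (polySpred h0) (polySpred DT0) addnS.
Qed.

End Torsor.

(** * The Galois group of B *)

Lemma frac_quotient (R : idomainType) (k : {fraction R}) :
  exists2 b : R, b != 0 & exists a, k * tofrac b = tofrac a.
Proof.
elim/quotW: k => r; exists (frac r).2; first exact: denom_ratioP.
exists (frac r).1; rewrite !piE; apply/eqmodP; rewrite /= FracField.equivfE.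
have nz := (oner_neq0, mulf_neq0, denom_ratioP).
rewrite /FracField.mulf !numden_Ratio ?nz //.
by rewrite !mulr1 mulrC.
Qed.

Lemma poly_rmorphE (R S : comNzRingType) (f : {rmorphism {poly R} -> S})
    (phi : {rmorphism R -> S}) :
  (forall c, f c%:P = phi c) -> forall a, f a = (map_poly phi a).[f 'X].
Proof.
move=> f_phi; elim/poly_ind=> [|a c IH]; first by rewrite !rmorph0 horner0.
rewrite !rmorphD !rmorphM IH f_phi /= map_polyC map_polyX.
by rewrite hornerD hornerM hornerC hornerX.
Qed.

Lemma map_poly_lift (R S : nzRingType) (phi : {rmorphism R -> S})
    (m : {poly S}) :
  (forall i, exists k, m`_i = phi k) -> exists m0, m = map_poly phi m0.
Proof.
move=> mP; have [c cP] := fin_all_exists (fun i : 'I_(size m) => mP i).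
exists (\sum_(i < size m) (c i)%:P * 'X^i).
rewrite -{1}[m]coefK poly_def rmorph_sum; apply: eq_bigr => i _.
by rewrite rmorphM /= map_polyC map_polyXn cP mul_polyC.
Qed.

Section Main.

Variables (p n : nat) (p_prime : prime p) (q_gt2 : (2 < p ^ n)%N).
Variables (F : finFieldType) (card_F : #|F| = (p ^ n)%N).
Variable L : splittingFieldType (ratfun p).

Let x : L := (ratfun_x p)%:A.

Lemma map_polyB :
  map_poly (GRing.in_alg L) (polyB p (p ^ n)) = artin_power L (p ^ n) - x%:P.
Proof.
by rewrite /polyB rmorphB /= map_polyC (map_artin_power (GRing.in_alg L)).
Qed.

Lemma x_powers i j : x ^+ i = x ^+ j -> i = j.
Proof.
rewrite -!(rmorphXn (GRing.in_alg L)) => /fmorph_inj.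
rewrite -[LHS]tofracXn -[RHS]tofracXn => /eqP; rewrite tofrac_eq => /eqP eqX.
have := congr1 (fun P : {poly 'F_p} => size P) eqX.
by rewrite !size_polyXn => -[].
Qed.

Definition constant_to_L : {rmorphism 'F_p -> L} :=
  GRing.in_alg L \o (@tofrac {poly 'F_p} \o polyC).

Lemma pchar_L : p \in [pchar L].
Proof. by rewrite (fmorph_pchar constant_to_L) pchar_Fp. Qed.

Lemma pchar_nat_L : [pchar L].-nat (p ^ n)%N.
Proof. by rewrite pnatX (pnatE _ p_prime) pchar_L. Qed.

(** In characteristic p the derivative of B is S^(q-2), where S = X^q - X, and
S^(q-2) * S - B = x is a nonzero constant: B is separable. *)
Lemma galois_B :
    splittingFieldFor 1%VS
      (map_poly (GRing.in_alg L) (polyB p (p ^ n))) {:L}%VS ->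
  galois 1 {:L}.
Proof.
move=> L_split; apply/splitting_galoisField.
exists (map_poly (GRing.in_alg L) (polyB p (p ^ n))); split=> //.
  by apply/polyOver1P; exists (polyB p (p ^ n)).
rewrite map_polyB unlock.
have natq0 (y : {poly L}) : y *+ (p ^ n) = 0.
  have chP : p \in [pchar {poly L}] by rewrite pchar_poly pchar_L.
  rewrite -mulr_natr.
  have /eqP-> : ((p ^ n)%:R == 0 :> {poly L}); last by rewrite mulr0.
  rewrite -(dvdn_pcharf chP) dvdn_exp //.
  by case: n q_gt2.
have -> : (artin_power L (p ^ n) - x%:P)^`() = ('X^(p ^ n) - 'X) ^+ (p ^ n).-2.
  rewrite derivB derivC subr0 deriv_exp derivB derivXn derivX natq0 sub0r.
  set y := _ * _; have : y *+ (p ^ n) = 0 := natq0 y.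
  rewrite -[in X in _ *+ X](ltn_predK q_gt2) mulrS => /(canRL (addKr _))->.
  by rewrite addr0 /y mulN1r opprK.
apply: coprimep_expr; apply/Bezout_coprimepP.
exists (-1, ('X^(p ^ n) - 'X) ^+ (p ^ n).-2) => /=.
have -> : -1 * (artin_power L (p ^ n) - x%:P) +
          ('X^(p ^ n) - 'X) ^+ (p ^ n).-2 * ('X^(p ^ n) - 'X) = x%:P.
  rewrite /artin_power -exprSr; case: (p ^ n)%N q_gt2 => [|[|k]] //= _.
  by ring.
rewrite polyC_eqp1; apply/eqP=> x0.
by have /x_powers : x ^+ 1 = x ^+ 2 by rewrite x0 !expr0n.
Qed.

Hypothesis L_split :
  splittingFieldFor 1%VS (map_poly (GRing.in_alg L) (polyB p (p ^ n))) {:L}%VS.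

Local Notation q := (p ^ n)%N.

Lemma exists_root_B : exists theta : L, (theta ^+ q - theta) ^+ q.-1 = x.
Proof.
case: L_split => rs; rewrite map_polyB => eqB _.
have q_gt1 : (1 < q)%N := ltnW q_gt2.
have T_gt1 := size_artin_power_gt1 L q_gt1.
have sB : (1 < size (artin_power L q - x%:P)%R)%N.
  rewrite size_polyDl // size_polyN (leq_ltn_trans (size_polyC_leq1 _)) //.
case: rs eqB => [|r rs] eqB.
  by move: sB; rewrite (eqp_size eqB) big_nil size_poly1.
exists r; have : root (artin_power L q - x%:P) r.
  by rewrite (eqp_root eqB) big_cons rootM root_XsubC eqxx.
by rewrite /root /artin_power !hornerE subr_eq0 => /eqP.
Qed.

Variable theta : L.
Hypothesis theta_root : (theta ^+ q - theta) ^+ q.-1 = x.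

Lemma exists_embedding : inhabited {rmorphism F -> L}.
Proof.
case: L_split => rs; rewrite map_polyB => eqB _.
have := splits_translate pchar_nat_L theta_root eqB; rewrite -card_F.
have [phi] := Fp_rmorph_exists (card_finPcharP card_F p_prime).
exact: (finField_embedding p_prime card_F phi constant_to_L).
Qed.

Variable iota : {rmorphism F -> L}.
Variable phi : {rmorphism 'F_p -> F}.

Lemma scalar_quotient (k : ratfun p) :
  exists2 b : {poly 'F_p}, b != 0 & exists a,
    k%:A * (map_poly iota (map_poly phi b)).[x]
    = (map_poly iota (map_poly phi a)).[x].
Proof.
have [b b0 [a Dk]] := frac_quotient k; exists b => //; exists a.
have evE (c : {poly 'F_p}) :
    (map_poly iota (map_poly phi c)).[x] = (tofrac c : ratfun p)%:A.
  pose f : {rmorphism {poly 'F_p} -> L} :=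
    GRing.in_alg L \o (@tofrac {poly 'F_p}).
  rewrite -map_poly_comp -[RHS]/(f c) (@poly_rmorphE _ _ f (iota \o phi)) //.
  exact: Fp_rmorph_unique constant_to_L _.
by rewrite !evE -(rmorphM (GRing.in_alg L)) -Dk.
Qed.

Lemma in_Fx_scalar (k : ratfun p) : in_Fx x iota k%:A.
Proof.
have [b b0 [a Dk]] := scalar_quotient k.
by exists (map_poly phi b); rewrite ?map_poly_eq0 //; exists (map_poly phi a).
Qed.

(** From z = a (x) / b (x) and the transcendence of x one gets z * b = a as
polynomials over F, so z is a quotient of coefficients of a and b. *)
Lemma scalar_constant (k : ratfun p) (z : F) :
  k%:A = iota z -> exists c, z = phi c.
Proof.
have [b b0 [a Dk]] := scalar_quotient k => kz.
have : (map_poly iota (z%:P * map_poly phi b)).[x]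
     = (map_poly iota (map_poly phi a)).[x].
  by rewrite rmorphM hornerM /= map_polyC hornerC -Dk /= -kz.
move/(poly_x_inj (ltnW q_gt2) theta_root x_powers) => eq_ab.
exists (a`_(size b).-1 / lead_coef b).
rewrite rmorphM fmorphV -coef_map -eq_ab coefCM coef_map mulfK //.
by rewrite fmorph_eq0 lead_coef_eq0.
Qed.

Lemma minPoly_in_constants (y : L) (Q : {poly F}) :
    minPoly 1%AS y = map_poly iota Q ->
  exists m, Q = map_poly phi m.
Proof.
move=> DQ; apply: map_poly_lift => i.
have /polyOver1P[P DP] := minPolyOver 1%AS y.
apply: (@scalar_constant P`_i).
by rewrite -coef_map -DQ DP (coef_map (GRing.in_alg L)).
Qed.

(** The minimal polynomial of iota g has coefficients in F_p, so g generates F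
over F_p by an equation of that degree: p^n <= p^degree. *)
Lemma degree_constant_extension (g : F) :
    (forall z : F, z != 0 -> exists k, z = g ^+ k) ->
  (n <= \dim <<1; iota g>>)%N.
Proof.
move=> gen_g; rewrite dim_Fadjoin dimv1 muln1.
set m := minPoly 1%AS (iota g).
have m_dvd : m %| \prod_(z : F) ('X - (iota z)%:P).
  rewrite -map_prod_XsubC -finField_genPoly rmorphB /= map_polyXn map_polyX.
  apply: minPoly_dvdp; first by rewrite rpredB ?rpredX ?polyOverX.
  by rewrite /root !hornerE card_F (iota_pow card_F) subrr.
have [mask] := dvdp_prod_XsubC m_dvd.
rewrite -map_prod_XsubC; set Q := \prod_(z <- _) _ => m_eq.
have {m_eq} Dm : m = map_poly iota Q.
  apply/eqP; rewrite -eqp_monic ?monic_minPoly //.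
  by rewrite map_monic monic_prod_XsubC.
have [m0 Dm0] := minPoly_in_constants Dm.
have rm0 : root (map_poly phi m0) g.
  by rewrite -Dm0 -(fmorph_root iota) -Dm root_minPoly.
have m0_neq0 : m0 != 0.
  rewrite -(map_poly_eq0 phi) -Dm0 -(map_poly_eq0 iota) -Dm.
  exact/monic_neq0/monic_minPoly.
have := finField_card_generated p_prime gen_g m0_neq0 rm0.
rewrite card_F leq_exp2l ?prime_gt1 // => /leq_trans-> //.
by rewrite -(size_map_poly phi) -Dm0 -(size_map_poly iota) -Dm size_minPoly.
Qed.

Lemma mem_gal1 (sigma : gal_of {:L}) : sigma \in 'Gal({:L} / 1)%g.
Proof. by rewrite gal_kHom ?sub1v // k1AHom. Qed.

Lemma gal_x (sigma : gal_of {:L}) : sigma x = x.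
Proof.
by apply: (fixed_gal (sub1v _) (mem_gal1 sigma)); rewrite rpredZ ?rpred1.
Qed.

Lemma gal_theta (sigma : gal_of {:L}) :
  exists ab : F * F, ab.1 != 0 /\ sigma theta = iota ab.1 * theta + iota ab.2.
Proof.
have [|a [b [a0 Dab]]] := @root_affine _ _ _ theta (ltnW q_gt2) pchar_nat_L
  theta_root x_powers _ card_F iota (sigma theta); last by exists (a, b).
by rewrite -rmorphXn -rmorphB -rmorphXn theta_root; apply: gal_x.
Qed.

(** The norm of theta to K (iota g) is a polynomial of degree |Gal (L / K
(iota g))| in theta, and it belongs to F(x). *)
Lemma degree_geometric_extension (g : F) :
  (q * q.-1 <= #|'Gal({:L} / <<1; iota g>>)%g|)%N.
Proof.
set E := <<1; iota g>>%AS.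
have galE : galois E {:L}.
  by apply: galoisS (galois_B L_split); rewrite sub1v subvf.
have [ab abP] := fin_all_exists gal_theta.
pose h : {poly F} :=
  \prod_(sigma in 'Gal({:L} / E)%g) ((ab sigma).1 *: 'X + (ab sigma).2%:P).
have size_lin sigma : size ((ab sigma).1 *: 'X + (ab sigma).2%:P) = 2.
  have [a0 _] := abP sigma.
  by rewrite size_polyDl size_scale ?size_polyX // ltnS size_polyC_leq1.
have size_h : (size h).-1 = #|'Gal({:L} / E)%g|.
  rewrite size_prod => [|sigma _]; last by rewrite -size_poly_eq0 size_lin.
  rewrite (eq_bigr (fun=> 2)) => [|sigma _]; last exact: size_lin.
  by rewrite sum_nat_const muln2 -addnn subSn ?leq_addl // addnK.
rewrite -size_h; apply: dvdn_leq; first by rewrite size_h cardG_gt0.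
apply: (degree_in_Fx (ltnW q_gt2) theta_root x_powers) (iota) _ _.
have -> : (map_poly iota h).[theta] = galNorm E {:L} theta.
  rewrite rmorph_prod horner_prod; apply: eq_bigr => sigma _.
  have [_ ->] := abP sigma.
  by rewrite rmorphD /= map_polyZ map_polyX map_polyC !hornerE.
have /Fadjoin_polyP[P /polyOver1P[P0 ->] ->] := mem_galNorm galE (memvf theta).
apply: in_Fx_horner; last exact: in_Fx_iota.
by move=> i; rewrite coef_map; apply: in_Fx_scalar.
Qed.

Lemma order_gal_ge : (n * q * q.-1 <= #|'Gal({:L} / 1)%g|)%N.
Proof.
have [g _ gen_g] := finField_generator F.
have galL := galois_B L_split.
set E := <<1; iota g>>%AS.
have galE : galois E {:L} by apply: galoisS galL; rewrite sub1v subvf.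
rewrite -(galois_dim galL) dimv1 divn1 -(divnK (field_dimS (subvf E))).
rewrite (galois_dim galE) -mulnA mulnC leq_mul //.
  exact: degree_geometric_extension.
exact: degree_constant_extension.
Qed.

Lemma gal_trivial (sigma : gal_of {:L}) :
  sigma theta = theta -> (forall z, sigma (iota z) = iota z) -> sigma = 1%g.
Proof.
move=> fix_theta fix_iota; apply/eqP/gal_eqP=> y _; rewrite gal_id.
case: L_split => rs; rewrite map_polyB => eqB Lrs.
have fix_rs : (<<1 & rs>> <= fixedField [set sigma])%VS.
  apply/Fadjoin_seqP; split; first exact: sub1v.
  move=> r r_rs; apply/fixedFieldP; rewrite ?memvf // => _ /set1P->.
  have : root (artin_power L q - x%:P) r.
    by rewrite (eqp_root eqB) root_prod_XsubC.
  rewrite /root /artin_power !hornerE subr_eq0 => /eqP root_r.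
  have [a [b [_ ->]]] := root_affine (ltnW q_gt2) pchar_nat_L theta_root
    x_powers card_F iota root_r.
  by rewrite rmorphD rmorphM /= !fix_iota fix_theta.
have y_rs : y \in <<1 & rs>>%VS by rewrite Lrs memvf.
by have [_] := mem_fixedFieldP (subvP fix_rs y y_rs); apply; apply: set11.
Qed.

Lemma gal_induces (sigma : gal_of {:L}) :
  exists s : {perm F}, s \in 'N(AGL1 F)%g /\ induces theta iota sigma s.
Proof.
have [|s] := @induces_exists _ _ x theta (ltnW q_gt2) pchar_nat_L theta_root
  x_powers _ card_F iota sigma; first exact: gal_x.
by exists s.
Qed.

Lemma gal_embeds_in_normalizer :
  exists f : {morphism 'Gal({:L} / 1)%g >-> {perm F}},
    ('injm f)%g /\ (f @* 'Gal({:L} / 1) \subset 'N(AGL1 F))%g.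
Proof.
have [s /all_and2[sN sI]] := fin_all_exists gal_induces.
have sM : {in 'Gal({:L} / 1)%g &, {morph s : sigma tau / (sigma * tau)%g}}.
  move=> sigma tau _ _; apply: (induces_unique theta_root x_powers) (sI _) _.
  move=> z.
  have [c c0 Dc] := induces_comp card_F (sI sigma) (sI tau) z.
  by exists c => //; rewrite galM ?memvf.
exists (Morphism sM); split; last first.
  by apply/subsetP=> _ /morphimP[sigma _ _ ->].
apply/subsetP=> sigma /morphpreP[_ /set1P /= s1]; apply/set1P.
have := sI sigma; rewrite s1 => /(induces_id theta_root x_powers card_F)[st si].
exact: gal_trivial.
Qed.

End Main.

Theorem theorem56 (p n : nat) (p_prime : prime p) (q_gt2 : (2 < p ^ n)%N)
    (Fq : finFieldType) (card_Fq : #|Fq| = (p ^ n)%N)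
    (L : splittingFieldType (ratfun p))
    (L_split : splittingFieldFor 1%VS
       (map_poly (GRing.in_alg L) (polyB p (p ^ n))) {:L}%VS) :
  ('Gal({:L} / 1) \isog Aut (AGL1 Fq))%g /\
  #|('Gal({:L} / 1))%g| = (n * (p ^ n) * (p ^ n).-1)%N.
Proof.
have [theta theta_root] := exists_root_B q_gt2 L_split.
have [iota] := exists_embedding p_prime card_Fq L_split theta_root.
have [phi] := Fp_rmorph_exists (card_finPcharP card_Fq p_prime).
have order_ge := order_gal_ge p_prime q_gt2 card_Fq L_split theta_root iota phi.
have [f [inj_f sfN]] :=
  gal_embeds_in_normalizer p_prime q_gt2 card_Fq L_split theta_root iota.
have inj_conj : ('injm (restrm sfN (conj_aut (AGL1 Fq))))%g.
  by rewrite ker_restrm ker_conj_aut cent_AGL1 ?card_Fq // setIC setI1g.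
set G := ('Gal({:L} / 1))%g in f inj_f sfN inj_conj order_ge *.
have isoG : (G \isog conj_aut (AGL1 Fq) @* (f @* G))%g.
  apply: isog_trans (sub_isog (subxx _) inj_f) _.
  have := sub_isog (subxx _) inj_conj.
  by rewrite morphim_restrm setIid.
have sub_Aut : (conj_aut (AGL1 Fq) @* (f @* G) \subset Aut (AGL1 Fq))%g.
  by apply: subset_trans (morphimS _ sfN) _; apply: Aut_conj_aut.
have Aut_le := card_Aut_AGL1_le p_prime card_Fq.
have card_G := card_isog isoG.
have eqAut : (conj_aut (AGL1 Fq) @* (f @* G) = Aut (AGL1 Fq))%g.
  apply/eqP; rewrite eqEcard sub_Aut -card_G (leq_trans Aut_le) //.
  by rewrite card_Fq.
have isoAut : (G \isog Aut (AGL1 Fq))%g by rewrite -eqAut.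
split=> //; apply/eqP; rewrite eqn_leq order_ge andbT.
by rewrite (card_isog isoAut) -card_Fq.
Qed.
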